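(* Let $m,n,n'\ge0$ be integers. For every $q\in\mathbb H$, $$\sqrt2^{\,m-n-n'}H^Q_{m,n+n'}(\sqrt2 q,\sqrt2\,\overline q)=\sum_{j=0}^m\binom mj H^Q_{m-j,n}(q,\overline q)\,H^Q_{j,n'}(q,\overline q),$$ $$\sqrt2^{\,m+n-n'}H^Q_{m,n+n'}(\sqrt2 q,\sqrt2\,\overline q)=\sum_{j=0}^m\sum_{k=0}^n\binom mj\binom nk H^Q_{m-j,n-k}(q,\overline q)\,H^Q_{j,k+n'}(q,\overline q),$$ $$H^Q_{m,n+n'}(q,\overline q)=\sum_{j=0}^{\min(m,n')}(-1)^j\frac{n'!}{(n'-j)!}\binom mj\,\overline q^{\,n'-j}H^Q_{m-j,n}(q,\overline q).$$
   Context: $\mathbb H$ is the algebra of real quaternions and $\overline q$ is the quaternionic conjugate. For integers $m,n\ge0$, $$H^Q_{m,n}(q,\overline q)=\sum_{k=0}^{\min(m,n)}(-1)^k k!\binom mk\binom nk q^{m-k}\overline q^{\,n-k}.$$ *)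

(* Defs.v *)
From HB Require Import structures.
From mathcomp Require Import all_boot all_order all_algebra.
From mathcomp Require Import reals.
From mathcomp Require Import ring.

Set Implicit Arguments.
Unset Strict Implicit.
Unset Printing Implicit Defensive.

Import Order.TTheory GRing.Theory Num.Theory.
Local Open Scope ring_scope.

(* [Quat a b c d] is a + b i + c j + d k with i^2 = j^2 = k^2 = i j k = -1. *)
Record quaternion (R : Type) : Type := Quat { q0 : R; q1 : R; q2 : R; q3 : R }.

Section QuaternionChoice.

Definition tuple_of_quat (R : Type) (q : quaternion R) : R * R * R * R :=
  (q0 q, q1 q, q2 q, q3 q).

Definition quat_of_tuple (R : Type) (t : R * R * R * R) : quaternion R :=
  let: (a, b, c, d) := t in Quat a b c d.

Lemma tuple_of_quatK (R : Type) :
  cancel (@tuple_of_quat R) (@quat_of_tuple R).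
Proof. by case. Qed.

End QuaternionChoice.

HB.instance Definition _ (R : eqType) :=
  Equality.copy (quaternion R) (can_type (@tuple_of_quatK R)).
HB.instance Definition _ (R : choiceType) :=
  Choice.copy (quaternion R) (can_type (@tuple_of_quatK R)).

Section QuaternionAlgebra.
Variable R : comNzRingType.
Implicit Types (x y z : quaternion R) (a b : R).

Definition addq x y : quaternion R :=
  Quat (q0 x + q0 y) (q1 x + q1 y) (q2 x + q2 y) (q3 x + q3 y).

Definition oppq x : quaternion R :=
  Quat (- q0 x) (- q1 x) (- q2 x) (- q3 x).

Definition zeroq : quaternion R := Quat 0 0 0 0.

Definition oneq : quaternion R := Quat 1 0 0 0.

Definition mulq x y : quaternion R :=
  Quat (q0 x * q0 y - q1 x * q1 y - q2 x * q2 y - q3 x * q3 y)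
       (q0 x * q1 y + q1 x * q0 y + q2 x * q3 y - q3 x * q2 y)
       (q0 x * q2 y - q1 x * q3 y + q2 x * q0 y + q3 x * q1 y)
       (q0 x * q3 y + q1 x * q2 y - q2 x * q1 y + q3 x * q0 y).

Definition scaleq a x : quaternion R :=
  Quat (a * q0 x) (a * q1 x) (a * q2 x) (a * q3 x).

Definition conjq x : quaternion R :=
  Quat (q0 x) (- q1 x) (- q2 x) (- q3 x).

Fact addqA : associative addq.
Proof. by move=> x y z; rewrite /addq /= !addrA. Qed.

Fact addqC : commutative addq.
Proof. by move=> x y; congr Quat; rewrite /= addrC. Qed.

Fact add0q : left_id zeroq addq.
Proof. by case=> a b c d; rewrite /addq /= !add0r. Qed.

Fact addNq : left_inverse zeroq oppq addq.
Proof. by move=> x; rewrite /addq /= !addNr. Qed.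

HB.instance Definition _ :=
  GRing.isZmodule.Build (quaternion R) addqA addqC add0q addNq.

Fact mulqA : associative mulq.
Proof. by move=> x y z; congr Quat => /=; ring. Qed.

Fact mul1q : left_id oneq mulq.
Proof. by case=> a b c d; congr Quat => /=; ring. Qed.

Fact mulq1 : right_id oneq mulq.
Proof. by case=> a b c d; congr Quat => /=; ring. Qed.

Fact mulqDl : left_distributive mulq +%R.
Proof. by move=> x y z; congr Quat => /=; ring. Qed.

Fact mulqDr : right_distributive mulq +%R.
Proof. by move=> x y z; congr Quat => /=; ring. Qed.

Fact oneq_neq0 : oneq != 0.
Proof. by apply/eqP => -[] /eqP; rewrite oner_eq0. Qed.

HB.instance Definition _ := GRing.Zmodule_isNzRing.Build (quaternion R)
  mulqA mul1q mulq1 mulqDl mulqDr oneq_neq0.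

Fact scaleqA a b x : scaleq a (scaleq b x) = scaleq (a * b) x.
Proof. by rewrite /scaleq /= !mulrA. Qed.

Fact scale1q : left_id 1 scaleq.
Proof. by case=> a b c d; rewrite /scaleq /= !mul1r. Qed.

Fact scaleqDr : right_distributive scaleq +%R.
Proof. by move=> a x y; congr Quat; rewrite /= mulrDr. Qed.

Fact scaleqDl x : {morph scaleq^~ x : a b / a + b}.
Proof. by move=> a b; congr Quat; rewrite /= mulrDl. Qed.

HB.instance Definition _ := GRing.Zmodule_isLmodule.Build R (quaternion R)
  scaleqA scale1q scaleqDr scaleqDl.

Fact scaleqAl a x y : a *: (x * y) = (a *: x) * y.
Proof. by congr Quat => /=; ring. Qed.

HB.instance Definition _ :=
  GRing.Lmodule_isLalgebra.Build R (quaternion R) scaleqAl.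

Fact scaleqAr a x y : a *: (x * y) = x * (a *: y).
Proof. by congr Quat => /=; ring. Qed.

HB.instance Definition _ :=
  GRing.Lalgebra_isAlgebra.Build R (quaternion R) scaleqAr.

Lemma conjqZ a x : conjq (a *: x) = a *: conjq x.
Proof. by congr Quat => /=; ring. Qed.

Lemma mulq_conj x : x * conjq x = conjq x * x.
Proof. by congr Quat => /=; ring. Qed.

(* The two quaternionic arguments are kept separate, as in the notation
   H^Q_{m,n}(q, \bar q); in use the second one is the conjugate of the first. *)
Definition hermiteQ (m n : nat) (q p : quaternion R) : quaternion R :=
  \sum_(0 <= k < (minn m n).+1)
    ((-1) ^+ k * (k`! * 'C(m, k) * 'C(n, k))%:R) *:
      (q ^+ (m - k) * p ^+ (n - k)).

End QuaternionAlgebra.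

(* Main.v *)
Require Import Defs.
From mathcomp Require Import all_boot all_order all_algebra.
From mathcomp Require Import reals.
From mathcomp Require Import ring zify.

(** Write [p] for the conjugate of [q]; the only fact about quaternions that
matters is that [p] and [q] commute.  For fixed [n] the exponential generating
function of [m |-> H_(m,n)] is
  [\sum_m H_(m,n) u^m / m! = e^(u q) (p - u)^n],
with [u] a central variable, and the three identities are visible on it.
- Rescaling [q], [p] and [u] by [sqrt 2] turns this function, with [n + n'] in
  place of [n], into [sqrt 2 ^ (n + n') e^(2 u q) (p - u)^(n + n')].  Up to that
  power of [sqrt 2] it is the product of the functions of [n] and [n'], and a
  product of exponential generating functions is a binomial convolution.
- In the double sum, the inner sum over [j] is the first identity for the pair
  [(n - k, k + n')], which has the same total as [(n, n')]; so every [k]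
  contributes the same value, with total weight [\sum_k 'C(n, k) = 2 ^ n].
- The third identity expands the factor [(p - u)^n'] of
  [(p - u)^n' (e^(u q) (p - u)^n)] by the binomial theorem.

No power series appear in the proof.  A sequence [f] stands for its generating
function, so that multiplication by [u] becomes [f |-> (m |-> m f (m - 1))], and
what is used about [(p - u)^n] is that its exponent grows by multiplication by
[p - u] ([egf_ladder]).  A family with this property is determined by its
members at [n = 0] ([egf_ladder_unique]) and expands over any earlier member by
the binomial theorem ([egf_ladder_iter]).  The Hermite polynomials form such a
family ([egf_ladder_hermiteQ]), and so do their normalized rescalings.  Binomial
convolution with a fixed sequence preserves the property, provided that [p]
commutes with that sequence when it stands on the left.  Hence the first
identity ([egf_mul_hermiteQ]) reduces, in [n'] and then in [n], to
[\sum_j 'C(m, j) q^(m - j) q^j = 2 ^ m q^m]. *)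

Import Order.TTheory GRing.Theory Num.Theory.
Local Open Scope ring_scope.

(** * Sequences as exponential generating functions *)

Section Ladder.
Context {R : comNzRingType} {A : algType R}.
Implicit Types (f g : nat -> A) (F G : nat -> nat -> A) (p : A).

(** Multiplication of [\sum_m f m u^m / m!] by the variable [u]; at [m = 0] the
factor [m] cancels the meaningless [f 0.-1]. *)
Definition egf_mulX f (m : nat) : A := m%:R *: f m.-1.

(** The product of two exponential generating functions. *)
Definition egf_mul f g (m : nat) : A :=
  \sum_(0 <= j < m.+1) 'C(m, j)%:R *: (f (m - j)%N * g j).

(** The generating function of [F^~ n.+1] is [p - u] times that of [F^~ n]. *)
Definition egf_ladder p F :=
  forall m n, F m n.+1 = p * F m n - egf_mulX (F^~ n) m.

Lemma egf_ladder_unique p F G : egf_ladder p F -> egf_ladder p G ->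
  (forall m, F m 0 = G m 0) -> forall m n, F m n = G m n.
Proof.
move=> HF HG FG0 m n; elim: n m => [|n IHn] m; first exact: FG0.
by rewrite HF HG /egf_mulX !IHn.
Qed.

(** The variable [u] is central, so it can be moved out of either factor of a
product; on coefficients this is [(m - j) 'C(m, j) = m 'C(m - 1, j)] for the
left factor and [j 'C(m, j) = m 'C(m - 1, j - 1)] for the right one. *)
Lemma egf_mul_mulXl f g m :
  egf_mul (egf_mulX f) g m = egf_mulX (egf_mul f g) m.
Proof.
rewrite /egf_mul /egf_mulX; case: m => [|m].
  by rewrite big_nat1 /= !scale0r mul0r scaler0.
rewrite big_nat_recr //= subnn scale0r mul0r scaler0 addr0 scaler_sumr.
apply: eq_big_nat => j /andP[_ jm].
rewrite -scalerAl !scalerA -!natrM [in LHS]mulnC -mul_bin_down.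
by have -> : (m.+1 - j).-1 = (m - j)%N by lia.
Qed.

Lemma egf_mul_mulXr f g m :
  egf_mul f (egf_mulX g) m = egf_mulX (egf_mul f g) m.
Proof.
rewrite /egf_mul /egf_mulX; case: m => [|m].
  by rewrite big_nat1 /= !scale0r mulr0 scaler0.
rewrite big_nat_recl //= scale0r mulr0 scaler0 add0r scaler_sumr.
apply: eq_big_nat => j /andP[_ jm].
by rewrite -scalerAr !scalerA -!natrM subSS [in LHS]mulnC -mul_bin_diag.
Qed.

Lemma egf_ladder_egf_mull p F g : egf_ladder p F ->
  egf_ladder p (fun m n => egf_mul (F^~ n) g m).
Proof.
move=> HF m n; rewrite -egf_mul_mulXl /egf_mul mulr_sumr -sumrB.
apply: eq_big_nat => j _.
by rewrite HF mulrBl scalerBr -scalerAr mulrA.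
Qed.

(** On the right, [p] has to be carried across the left factor [f]. *)
Lemma egf_ladder_egf_mulr p f G : (forall m, GRing.comm p (f m)) -> egf_ladder p G ->
  egf_ladder p (fun m n => egf_mul f (G^~ n) m).
Proof.
move=> pf HG m n; rewrite -egf_mul_mulXr /egf_mul mulr_sumr -sumrB.
apply: eq_big_nat => j _.
by rewrite HG mulrBr scalerBr -[in RHS]scalerAr !mulrA pf.
Qed.

(** The binomial theorem for [(p - u)^n'], where [p] commutes with [u]: the
power [u^j] acts on sequences as [f |-> (m |-> m ^_ j f (m - j))]. *)
Lemma egf_ladder_iter p F m n n' : egf_ladder p F ->
  F m (n + n')%N =
  \sum_(0 <= j < n'.+1)
    ((-1) ^+ j * ('C(n', j) * m ^_ j)%:R) *: (p ^+ (n' - j) * F (m - j)%N n).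
Proof.
move=> HF; elim: n' n => [|n' IHn'] n.
  by rewrite big_nat1 addn0 !subn0 bin0 ffactn0 muln1 !expr0 !mul1r scale1r.
rewrite addnS -addSn IHn'.
pose T (a j i : nat) :=
  ((-1) ^+ j * (a * m ^_ j)%:R) *: (p ^+ i * F (m - j)%N n).
(* The two sums are the parts [p] and [- u] of the factor that is split off;
   Pascal's rule then merges them. *)
transitivity (\sum_(0 <= j < n'.+1) T 'C(n', j) j (n'.+1 - j)%N
             + \sum_(0 <= j < n'.+1) T 'C(n', j) j.+1 (n' - j)%N).
  rewrite -big_split /=; apply: eq_big_nat => j /andP[_ jn].
  rewrite HF mulrBr scalerBr /T /egf_mulX mulrA -exprSr -subSn //.
  congr (_ + _); rewrite -scalerAr scalerA -scaleNr subnS.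
  by congr (_ *: _); rewrite exprS ffactnSr !natrM; ring.
rewrite [RHS]big_nat_recl // [X in X + _]big_nat_recl //.
rewrite !bin0 -addrA; congr (_ + _).
under [RHS]eq_big_nat => j _.
  rewrite binS mulnDl natrD mulrDr scalerDl subSS. over.
rewrite big_split /=; congr (_ + _).
by rewrite big_nat_recr //= bin_small // mul0n mulr0 scale0r addr0.
Qed.

End Ladder.

(** * The Hermite polynomials as a ladder *)

Section Hermite.
Context {R : comNzRingType}.
Implicit Types (p q : quaternion R).

(** The binomial coefficients vanish past [minn m n], so the range of summation
can be chosen independently of how [m] and [n] compare. *)
Lemma hermiteQ_extend m n N q p : (minn m n <= N)%N ->
  hermiteQ m n q p = \sum_(0 <= k < N.+1)
    ((-1) ^+ k * (k`! * 'C(m, k) * 'C(n, k))%:R) *: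
      (q ^+ (m - k) * p ^+ (n - k)).
Proof.
move=> mnN; rewrite [RHS](big_cat_nat (n := (minn m n).+1)) //=.
rewrite [X in _ = _ + X]big_nat [X in _ = _ + X]big1 ?addr0 // => k /andP[mnk _].
have : (m < k)%N || (n < k)%N by rewrite -gtn_min.
by case/orP => /bin_small ->; rewrite ?muln0 ?mul0n mulr0 scale0r.
Qed.

Lemma hermiteQ0 m q p : hermiteQ m 0 q p = q ^+ m.
Proof.
by rewrite /hermiteQ minn0 big_nat1 !bin0 fact0 !subn0 !expr0 !mulr1 scale1r.
Qed.

(** Pascal's rule on ['C(n.+1, k)] splits the sum in two, the second part being
the [u]-term because [k! 'C(m, k) = m (k - 1)! 'C(m - 1, k - 1)]. *)
Lemma egf_ladder_hermiteQ q p : GRing.comm p q ->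
  egf_ladder p (fun m n => hermiteQ m n q p).
Proof.
move=> pq m n; rewrite /egf_mulX.
rewrite (@hermiteQ_extend m n.+1 n.+1) ?geq_minr //.
rewrite (@hermiteQ_extend m n n.+1); last by lia.
rewrite (@hermiteQ_extend m.-1 n n) ?geq_minr //.
rewrite big_nat_recl // [in RHS]big_nat_recl // mulrDr -addrA; congr (_ + _).
  by rewrite !bin0 -scalerAr !subn0 mulrA (commrX m pq) -mulrA -exprS.
rewrite mulr_sumr scaler_sumr -sumrB; apply: eq_big_nat => k /andP[_ kn].
rewrite -scalerAr mulrA (commrX (m - k.+1) pq) -mulrA -exprS scalerA !subSS.
have -> : (m.-1 - k = m - k.+1)%N by lia.
have -> : m%:R * ((-1) ^+ k * (k`! * 'C(m.-1, k) * 'C(n, k))%:R)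
    = - ((-1) ^+ k.+1 * (k.+1`! * 'C(m, k.+1) * 'C(n, k))%:R) :> R.
  rewrite factS exprS.
  have -> : (k.+1 * k`! * 'C(m, k.+1) = k`! * (m * 'C(m.-1, k)))%N.
    by rewrite mul_bin_diag mulnCA mulnA.
  by rewrite !natrM; ring.
rewrite scaleNr opprK binS mulnDr natrD mulrDr scalerDl; congr (_ + _).
(* At [k = n] the exponent [n - k.+1] is truncated, but the binomial
   coefficient ['C(n, k.+1)] is zero. *)
have [kn'|] := ltnP k n; first by rewrite -subSn.
by move=> nk; rewrite (@bin_small n k.+1) ?muln0 ?mulr0 ?scale0r // ltnS.
Qed.

Lemma comm_hermiteQ m n q p : GRing.comm p q -> GRing.comm p (hermiteQ m n q p).
Proof.
move=> pq; apply: commr_sum => k _.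
rewrite /GRing.comm -scalerAr -scalerAl; congr (_ *: _).
by apply: commrM; [exact: commrX | exact/commrX].
Qed.

End Hermite.

(** * The three identities *)

Lemma sum_bin n : (\sum_(0 <= j < n.+1) 'C(n, j) = 2 ^ n)%N.
Proof.
rewrite big_mkord -[2%N]/(1 + 1)%N expnDn; apply: eq_bigr => i _.
by rewrite !exp1n !muln1.
Qed.

(** Both sides are ladders in [n'], since the power of [sqrt 2] is chosen so that
rescaling both variables leaves the step [p - u] unchanged.  This reduces the
claim to [n' = 0], where both sides are ladders in [n], and so to
[n = n' = 0]. *)
Lemma egf_mul_hermiteQ (R : realType) (m n n' : nat) (q p : quaternion R) :
  GRing.comm p q ->
  (Num.sqrt 2 : R) ^ (m%:Z - n%:Z - n'%:Z) *:
    hermiteQ m (n + n') (Num.sqrt 2 *: q) (Num.sqrt 2 *: p)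
  = egf_mul (fun i => hermiteQ i n q p) (fun i => hermiteQ i n' q p) m.
Proof.
move=> pq; set s := Num.sqrt 2 : R.
have s0 : s != 0 by rewrite gt_eqF // sqrtr_gt0 ltr0n.
have ss : s * s = 2 by rewrite -expr2 sqr_sqrtr.
pose F m n := s ^ (m%:Z - n%:Z) *: hermiteQ m n (s *: q) (s *: p).
have HF : egf_ladder p F.
  move=> {}m {}n; rewrite /F egf_ladder_hermiteQ /egf_mulX.
    rewrite scalerBr -scalerAl -scalerAr !scalerA; congr (_ *: _ - _).
      by rewrite -[s in _ * s]expr1z -expfzDr //; congr (_ ^ _); lia.
    case: m => [|m]; first by rewrite mulr0 mul0r !scale0r.
    by rewrite mulrC /=; congr (_ * _ ^ _ *: _); lia.
  by rewrite /GRing.comm -!scalerAl -!scalerAr !scalerA pq.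
have F0 i : F i 0 = egf_mul (fun i => q ^+ i) (fun i => q ^+ i) i.
  rewrite /F hermiteQ0 exprZn scalerA subr0 -exprnP -exprMn ss.
  rewrite /egf_mul; under eq_big_nat => j /andP[_ ji] do
    rewrite -exprD subnK //.
  by rewrite -scaler_suml -natr_sum sum_bin natrX.
have Fn0 i j : F i j = egf_mul (fun i => hermiteQ i j q p) (fun i => q ^+ i) i.
  move: i j; apply: (egf_ladder_unique p) => //.
    by apply: egf_ladder_egf_mull; apply: egf_ladder_hermiteQ.
  by move=> i; rewrite F0; apply: eq_big_nat => j _; rewrite hermiteQ0.
have -> : m%:Z - n%:Z - n'%:Z = m%:Z - (n + n')%:Z by lia.
rewrite -/(F m (n + n')%N).
apply: (egf_ladder_unique p (fun m n' => F m (n + n')%N)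
  (fun m n' => egf_mul (fun i => hermiteQ i n q p)
                         (fun i => hermiteQ i n' q p) m)).
- by move=> i j; rewrite addnS HF.
- by apply: egf_ladder_egf_mulr => [i|]; [exact: comm_hermiteQ|exact: egf_ladder_hermiteQ].
- by move=> i; rewrite addn0 Fn0; apply: eq_big_nat => j _; rewrite hermiteQ0.
Qed.

Theorem proposition3p11 (R : realType) (m n n' : nat) (q : quaternion R) :
  [/\ (Num.sqrt 2 : R) ^ (m%:Z - n%:Z - n'%:Z) *:
        hermiteQ m (n + n') (Num.sqrt 2 *: q) (Num.sqrt 2 *: conjq q)
      = \sum_(0 <= j < m.+1)
          'C(m, j)%:R *:
            (hermiteQ (m - j) n q (conjq q) * hermiteQ j n' q (conjq q)),
      (Num.sqrt 2 : R) ^ (m%:Z + n%:Z - n'%:Z) *: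
        hermiteQ m (n + n') (Num.sqrt 2 *: q) (Num.sqrt 2 *: conjq q)
      = \sum_(0 <= j < m.+1) \sum_(0 <= k < n.+1)
          ('C(m, j)%:R * 'C(n, k)%:R) *:
            (hermiteQ (m - j) (n - k) q (conjq q) *
             hermiteQ j (k + n') q (conjq q))
    & hermiteQ m (n + n') q (conjq q)
      = \sum_(0 <= j < (minn m n').+1)
          ((-1) ^+ j * (n'`!%:R / (n' - j)`!%:R) * 'C(m, j)%:R) *:
            (conjq q ^+ (n' - j) * hermiteQ (m - j) n q (conjq q))].
Proof.
have pq : GRing.comm (conjq q) q by rewrite /GRing.comm -mulq_conj.
split; first exact: egf_mul_hermiteQ.
- set s := Num.sqrt 2 : R; set H := hermiteQ m _ _ _.
  have s0 : s != 0 by rewrite gt_eqF // sqrtr_gt0 ltr0n.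
  have s2 : s ^+ 2 = 2 by rewrite sqr_sqrtr.
  rewrite exchange_big_nat /=.
  transitivity (\sum_(0 <= k < n.+1)
      'C(n, k)%:R *: (s ^ (m%:Z - n%:Z - n'%:Z) *: H)); last first.
    apply: eq_big_nat => k /andP[_ kn].
    under eq_bigr do rewrite mulrC -scalerA.
    rewrite -scaler_sumr; congr (_ *: _).
    have -> : m%:Z - n%:Z - n'%:Z = m%:Z - (n - k)%N%:Z - (k + n')%N%:Z by lia.
    have -> : H = hermiteQ m (n - k + (k + n'))%N (s *: q) (s *: conjq q).
      by rewrite addnA subnK.
    exact: egf_mul_hermiteQ.
  rewrite -scaler_suml -natr_sum sum_bin.
  rewrite scalerA natrX -s2 -exprM exprnP -expfzDr //.
  by congr (_ ^ _ *: _); lia.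
- rewrite (egf_ladder_iter _ _ _ _ _ (egf_ladder_hermiteQ _ _ pq)).
  rewrite (big_cat_nat (n := (minn m n').+1)) //=; last by rewrite ltnS geq_minr.
  rewrite [X in _ + X]big_nat [X in _ + X]big1 ?addr0; last first.
    move=> j /andP[mj jn]; rewrite ffact_small ?muln0 ?mulr0 ?scale0r //; lia.
  apply: eq_big_nat => j /andP[_ jmn]; congr (_ *: _); rewrite -mulrA.
  have jn : (j <= n')%N by lia.
  congr (_ * _); rewrite -(bin_fact jn) -bin_ffact !natrM.
  have : (n' - j)`!%:R != 0 :> R by rewrite pnatr_eq0 -lt0n fact_gt0.
  by move=> fact_neq0; field.
Qed.
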